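(* Let $K$ be a nonempty closed max cone in $\mathbb{R}^n_+$. Then $K$ is generated by its set of extremals, and any point in $K$ is a max combination of not more than $n$ extremals of $K$.
   Context: $\mathbb{R}^n_+$ is the set of vectors with nonnegative real entries; $a\oplus b=\max(a,b)$, extended componentwise to vectors. A max cone is a subset of $\mathbb{R}^n_+$ closed under $\oplus$ and under multiplication by nonnegative reals; it is called closed if it is a closed subset of $\mathbb{R}^n_+$ (equivalently of $\mathbb{R}^n$) in the Euclidean topology. $\operatorname{span}(S)$ is the set of all max combinations $\bigoplus_{x\in S}\lambda_x x$ with $\lambda_x\ge 0$ and only finitely many $\lambda_x\neq 0$; $\operatorname{span}(\emptyset)=\{0\}$. $K$ is generated by $S$ if $\operatorname{span}(S)=K$. An element $u\in K$ is an extremal in $K$ if $u=v\oplus w$ with $v,w\in K$ implies $u=v$ or $u=w$. *)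

(* Defs.v *)
(* MathComp-Analysis.  [R : realType] is the field of real numbers and a point
   of R^n is a row vector ['rV[R]_n]. *)
From HB Require Import structures.
From mathcomp Require Import all_boot all_order all_algebra finmap.
From mathcomp Require Import all_classical all_reals all_analysis.

Set Implicit Arguments.
Unset Strict Implicit.
Unset Printing Implicit Defensive.

Import Order.TTheory GRing.Theory Num.Theory.
Import numFieldNormedType.Exports.

Local Open Scope classical_set_scope.
Local Open Scope ring_scope.

Definition orthant (R : realType) (n : nat) : set 'rV[R]_n :=
  [set u | forall j, 0 <= u ord0 j].

Definition vmax (R : realType) (n : nat) (u v : 'rV[R]_n) : 'rV[R]_n :=
  map2_mx Num.max u v.

(* The empty set satisfies this; a nonempty max cone contains 0. *)
Definition max_cone (R : realType) (n : nat) (K : set 'rV[R]_n) : Prop :=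
  [/\ K `<=` @orthant R n,
      forall u v, K u -> K v -> K (vmax u v)
    & forall (a : R) u, 0 <= a -> K u -> K (a *: u)].

(* [y] is a max combination of the points of the finite set [A].  The bottom
   value 0 of the iterated maximum is neutral on the nonnegative orthant only,
   so this is meant for [A] contained in the orthant; the max combination of
   the empty family is 0. *)
Definition max_combination (R : realType) (n : nat)
    (A : {fset 'rV[R]_n}) (y : 'rV[R]_n) : Prop :=
  exists lam : 'rV[R]_n -> R,
    (forall x, 0 <= lam x) /\
    y = \big[@vmax R n/0]_(x <- enum_fset A) (lam x *: x).

(* A finitely supported family of coefficients on [S] is given by a finite
   subset [A] of [S] containing its support. *)
Definition max_span (R : realType) (n : nat) (S : set 'rV[R]_n) :
    set 'rV[R]_n :=
  [set y | exists A : {fset 'rV[R]_n}, [set` A] `<=` S /\ max_combination A y].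

Definition generated_by (R : realType) (n : nat) (K S : set 'rV[R]_n) : Prop :=
  max_span S = K.

(* With this definition the zero vector of a cone is extremal. *)
Definition extremals (R : realType) (n : nat) (K : set 'rV[R]_n) :
    set 'rV[R]_n :=
  [set u | K u /\ forall v w, K v -> K w -> u = vmax v w -> u = v \/ u = w].

(* Main.v *)
(* For [y] in [K] and a coordinate [j], the points of [K] below [y] that agree
   with [y] at [j] form a nonempty compact set, and any point [u] of it with
   least coordinate sum is minimal for the componentwise order.  Such a [u] is
   extremal: if [u] is the maximum of [v] and [w], one of them agrees with [y]
   at [j], hence lies in the set and below [u], hence equals [u].  The maximum
   of these [n] extremals, one for each coordinate, is [y]. *)
Require Import Defs.
From HB Require Import structures.
From mathcomp Require Import all_boot all_order all_algebra finmap.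
From mathcomp Require Import all_classical all_reals all_analysis.

Set Implicit Arguments.
Unset Strict Implicit.
Unset Printing Implicit Defensive.

Import Order.TTheory GRing.Theory Num.Theory.
Import numFieldNormedType.Exports.

Local Open Scope classical_set_scope.
Local Open Scope ring_scope.

Lemma big_vmaxE (R : realType) (n : nat) (I : Type) (r : seq I)
    (F : I -> 'rV[R]_n) (j : 'I_n) :
  (\big[@vmax R n/0]_(i <- r) F i) ord0 j =
  \big[Num.max/0]_(i <- r) F i ord0 j.
Proof.
by elim/big_rec2: _ => [|i x y _ <-]; rewrite ?mxE.
Qed.

(** Nonemptiness covers the empty maximum: for any [u] in [K], the bottom value is [0 *: u], which
    lies in [K]. *)
Lemma max_cone_big_vmax (R : realType) (n : nat) (K : set 'rV[R]_n)
    (I : eqType) (r : seq I) (F : I -> 'rV[R]_n) :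
  K !=set0 -> max_cone K -> (forall i, i \in r -> K (F i)) ->
  K (\big[@vmax R n/0]_(i <- r) F i).
Proof.
move=> [u Ku] [_ Kmax Kscale] KF; rewrite big_seq.
by apply: big_ind => //; rewrite -(scale0r u); apply: Kscale.
Qed.

Lemma compact_below_agreeing (R : realType) (n : nat) (K : set 'rV[R]_n)
    (y : 'rV[R]_n) (j : 'I_n) :
  K `<=` @orthant R n -> closed K ->
  compact [set u | [/\ K u, forall i, u ord0 i <= y ord0 i
                     & u ord0 j = y ord0 j]].
Proof.
move=> Kpos Kclosed.
(* The segment at [j] degenerates to the point [y ord0 j], which encodes the agreement there.
   Elsewhere the lower end 0 comes from the orthant. The set is thus a compact box cut by the closed
   set [K]. *)
pose B i := `[(if i == j then y ord0 i else 0), y ord0 i]%classic.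
suff -> : [set u | [/\ K u, forall i, u ord0 i <= y ord0 i
                      & u ord0 j = y ord0 j]] =
          [set u : 'rV[R]_n | forall i, B i (u ord0 i)] `&` K.
  by apply: compact_closedI => //; apply: rV_compact => i; exact: segment_compact.
apply/seteqP; split=> u /=.
  case=> Ku le_uy uj; split=> // i; rewrite /B /= in_itv /= le_uy andbT.
  by case: eqP => [->|_]; [rewrite uj | exact: Kpos].
case=> Bu Ku; split=> //.
  by move=> i; have := Bu i; rewrite /B /= in_itv /= => /andP[].
by have := Bu j; rewrite /B /= in_itv /= eqxx -eq_le => /eqP.
Qed.

Lemma row_sum_continuous (R : realType) (n : nat) :
  continuous (fun u : 'rV[R]_n => \sum_j u ord0 j).
Proof.
apply: continuous_big => [|j _]; last exact: coord_continuous.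
exact: add_continuous.
Qed.

(** The entries of [u - v] are nonnegative with sum at most 0, so they all vanish. This turns a
    least coordinate sum into minimality for the componentwise order. *)
Lemma le_sum_eq_row (R : realType) (n : nat) (u v : 'rV[R]_n) :
  (forall j, v ord0 j <= u ord0 j) ->
  \sum_j u ord0 j <= \sum_j v ord0 j -> u = v.
Proof.
move=> le_vu le_sum; apply/rowP => j; apply/eqP; rewrite -subr_eq0; apply/eqP.
apply: (@psumr_eq0P _ _ xpredT (fun j => u ord0 j - v ord0 j)) => // [i _|].
  by rewrite subr_ge0.
apply/eqP; rewrite sumrB eq_le subr_le0 le_sum subr_ge0.
by apply: ler_sum => i _.
Qed.

Lemma exists_extremal_below (R : realType) (n : nat) (K : set 'rV[R]_n)
    (y : 'rV[R]_n) (j : 'I_n) :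
  max_cone K -> closed K -> K y ->
  exists u, [/\ extremals K u, forall i, u ord0 i <= y ord0 i
              & u ord0 j = y ord0 j].
Proof.
move=> [Kpos _ _] Kclosed Ky.
pose D := [set u | [/\ K u, forall i, u ord0 i <= y ord0 i
                     & u ord0 j = y ord0 j]].
have [u /set_mem[Ku le_uy uj] u_min] : exists2 u, u \in D &
    forall v, v \in D -> \sum_i u ord0 i <= \sum_i v ord0 i.
  apply: compact_EVT_min; first by exists y.
    exact: compact_below_agreeing.
  exact/continuous_subspaceT/row_sum_continuous.
have u_minimal v : K v -> (forall i, v ord0 i <= u ord0 i) ->
    v ord0 j = u ord0 j -> u = v.
  (* Such a [v] is again in [D], being below [u], hence below [y], and equal to [y] at [j]. *)
  move=> Kv le_vu vj; apply: le_sum_eq_row => //; apply/u_min/mem_set.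
  by split; [|move=> i; exact: le_trans (le_vu i) (le_uy i)|rewrite vj].
exists u; split=> //; split=> // v w Kv Kw u_vw.
have uE i : u ord0 i = Num.max (v ord0 i) (w ord0 i) by rewrite u_vw mxE.
have [le_vw|le_wv] := leP (v ord0 j) (w ord0 j).
  right; apply: u_minimal => // [i|]; first by rewrite uE le_max lexx orbT.
  by rewrite uE max_r.
left; apply: u_minimal => // [i|]; first by rewrite uE le_max lexx.
by rewrite uE max_l // ltW.
Qed.

Lemma max_combination_extremals (R : realType) (n : nat) (K : set 'rV[R]_n)
    (y : 'rV[R]_n) :
  max_cone K -> closed K -> K y ->
  exists A : {fset 'rV[R]_n},
    [/\ (#|` A| <= n)%N, [set` A] `<=` extremals K & max_combination A y].
Proof.
move=> Kcone Kclosed Ky.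
have /choice[x xP] : forall j, exists u, [/\ extremals K u,
    forall i, u ord0 i <= y ord0 i & u ord0 j = y ord0 j].
  by move=> j; exact: exists_extremal_below.
(* Several coordinates may share one extremal, so the image has at most [n] elements. *)
exists [fset x j | j in 'I_n]%fset; split.
- by apply: leq_trans (leq_imfset_card _ _ _) _; rewrite -cardE card_ord.
- by move=> u /= /imfsetP[j _ ->]; case: (xP j).
exists (fun=> 1); split=> // ; apply/rowP => j; rewrite big_vmaxE.
(* At coordinate [j] the member [x j] already attains [y ord0 j]. Conversely every member is below
   [y], and so is the bottom value 0 because [y] lies in the orthant. *)
have [Kpos _ _] := Kcone; apply/eqP; rewrite eq_le; apply/andP; split.
  have [_ _ <-] := xP j; rewrite -{1}[x j]scale1r.
  by apply: (le_bigmax_seq 0 (x j)) => //; apply: in_imfset.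
rewrite big_seq; apply: bigmax_le => [|u /imfsetP[i _ ->]]; first exact: Kpos.
by rewrite scale1r; case: (xP i).
Qed.

Theorem proposition24 (R : realType) (n : nat) (K : set 'rV[R]_n)
    (K_nonempty : K !=set0) (K_cone : max_cone K) (K_closed : closed K) :
  generated_by K (extremals K) /\
  (forall y : 'rV[R]_n, K y ->
     exists A : {fset 'rV[R]_n},
       [/\ (#|` A| <= n)%N, [set` A] `<=` extremals K & max_combination A y]).
Proof.
split=> [|y]; last exact: max_combination_extremals.
apply/seteqP; split=> y.
  case=> A [A_ext [lam [lam_ge0 ->]]].
  apply: max_cone_big_vmax => // x xA; have [_ _ Kscale] := K_cone.
  by apply: Kscale => //; case: (A_ext x xA).
by case/(max_combination_extremals K_cone K_closed) => A [_ ? ?]; exists A.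
Qed.
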